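(* Let $\Sigma \subset \mathbb{R}^d$ be a bounded, smooth $k$-manifold, and let $M$ be its medial axis. Let $\tau$ be a simplex (of any dimension) whose vertices lie on $\Sigma$. Let $B_\tau$ be a closed $d$-ball such that $B_\tau \supseteq \tau$ (e.g., $\tau$'s smallest enclosing ball or $\tau$'s diametric ball), let $c$ be its center, and let $r$ be its radius. For every point $x \in \tau$ such that $x \notin M$, with $\tilde{x}$ the point of $\Sigma$ nearest $x$, if $r < \mathrm{ebs}(\tilde{x})$ then $$|x\tilde{x}| \leq \mathrm{ebs}(\tilde{x}) - \sqrt{\mathrm{ebs}(\tilde{x})^2 - r^2 + |xc|^2} \leq \mathrm{ebs}(\tilde{x}) - \sqrt{\mathrm{ebs}(\tilde{x})^2 - r^2} = \frac{r^2}{2\,\mathrm{ebs}(\tilde{x})} + O\left(\frac{r^4}{\mathrm{ebs}(\tilde{x})^3}\right),$$ and if $r < \mathrm{lfs}(\tilde{x})$ then $$|x\tilde{x}| \leq \mathrm{lfs}(\tilde{x}) - \sqrt{\mathrm{lfs}(\tilde{x})^2 - r^2 + |xc|^2} \leq \mathrm{lfs}(\tilde{x}) - \sqrt{\mathrm{lfs}(\tilde{x})^2 - r^2} = \frac{r^2}{2\,\mathrm{lfs}(\tilde{x})} + O\left(\frac{r^4}{\mathrm{lfs}(\tilde{x})^3}\right).$$ The first inequality in each line is sharp for balls that circumscribe $\tau$ (that is, when every vertex of $\tau$ lies on the boundary of $B_\tau$): there exists a $\Sigma$ such that $$|x\tilde{x}| = \mathrm{ebs}(\tilde{x}) - \sqrt{\mathrm{ebs}(\tilde{x})^2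 - r^2 + |xc|^2} = \mathrm{lfs}(\tilde{x}) - \sqrt{\mathrm{lfs}(\tilde{x})^2 - r^2 + |xc|^2}$$ for every simplex $\tau$ whose vertices lie on $\Sigma$, every $x \in \tau \setminus M$, and every ball $B_\tau$ (with center $c$ and radius $r$) that circumscribes $\tau$ and has radius $r < \mathrm{ebs}(\tilde{x})$. The second inequality in each line is sharp when $x = c$.
   Context: $|pq|$ denotes the Euclidean distance between $p,q \in \mathbb{R}^d$. The manifold $\Sigma$ is embedded in $\mathbb{R}^d$. For $p \in \Sigma$, $T_p\Sigma$ is the $k$-flat tangent to $\Sigma$ at $p$, and the normal space $N_p\Sigma$ is the $(d-k)$-flat through $p$ orthogonal to $T_p\Sigma$. The medial axis $M \subset \mathbb{R}^d$ of $\Sigma$ is the closure of the set of points of $\mathbb{R}^d$ that have more than one nearest point on $\Sigma$. A medial ball is an open ball centered at a point of $M$, disjoint from $\Sigma$, whose boundary intersects $\Sigma$. For $p \in \Sigma$, the local feature size is $\mathrm{lfs}(p) = \min_{m \in M} |pm|$, and the empty ball size $\mathrm{ebs}(p) = \min_{m \in M \cap N_p\Sigma} |pm|$ is the radius of the smallest medial ball tangent to $\Sigma$ at $p$. In particular $\mathrm{lfs}(p) \le \mathrm{ebs}(p)$. The smallest enclosing ball of $\tau$ is the smallest closed $d$-ball containing $\tau$; the diametric ball of $\tau$ is the smallest closed $d$-ball whose boundary contains all of $\tau$'s vertices.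
   Formalization: The bounded, smooth k-manifold Σ is taken to be closed as a subset of R^d (compact, without boundary); for a non-closed Σ, such as two disjoint open segments, nearest points may fail to exist and the lfs bound can fail. *)

(* Defs.v *)
(* MathComp-Analysis *)
From HB Require Import structures.
From mathcomp Require Import all_boot all_order all_algebra.
From mathcomp Require Import all_classical all_reals all_analysis.
Set Implicit Arguments.
Unset Strict Implicit.
Unset Printing Implicit Defensive.
Import Order.TTheory GRing.Theory Num.Theory.
Import numFieldNormedType.Exports.
Local Open Scope classical_set_scope.
Local Open Scope ring_scope.

(* The canonical norm on 'rV[R]_d is the sup norm. It induces the usual
   topology and the usual bounded sets, but metric quantities below are all
   expressed with the Euclidean distance. *)
Definition dot {R : realType} {d : nat} (u v : 'rV[R]_d) : R :=
  \sum_(i < d) u 0 i * v 0 i.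

Definition eucl_dist {R : realType} {d : nat} (p q : 'rV[R]_d) : R :=
  Num.sqrt (dot (p - q) (p - q)).

Definition cball {R : realType} {d : nat} (c : 'rV[R]_d) (r : R)
    : set 'rV[R]_d :=
  [set y | eucl_dist c y <= r].

(* f is of class C^n on A; meant for A open, where 'D_v f on A depends only on
   f on A. *)
Fixpoint Cn_on {R : realType} {V W : normedModType R} (n : nat) (A : set V)
    (f : V -> W) : Prop :=
  match n with
  | 0 => forall x, A x -> {for x, continuous f}
  | m.+1 => (forall x, A x -> differentiable f x) /\
            (forall v : V, Cn_on m A ('D_v f))
  end.

Definition smooth_on {R : realType} {V W : normedModType R} (A : set V)
    (f : V -> W) : Prop :=
  forall n, Cn_on n A f.

(* Every p in Sigma has a neighborhood W such that Sigma `&` W is diffeomorphic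
   to an open subset U of R^k; smoothness of the inverse on Sigma `&` W means
   that it is the restriction of a map psi that is smooth on W. *)
Definition smooth_submanifold {R : realType} {d : nat} (k : nat)
    (Sigma : set 'rV[R]_d) : Prop :=
  forall p, Sigma p ->
  exists (U : set 'rV[R]_k) (W : set 'rV[R]_d)
         (phi : 'rV[R]_k -> 'rV[R]_d) (psi : 'rV[R]_d -> 'rV[R]_k),
  [/\ open U, open W & W p] /\
  [/\ smooth_on U phi, smooth_on W psi, phi @` U = Sigma `&` W &
      forall u, U u -> psi (phi u) = u].

(* [closed Sigma] excludes manifolds with missing limit points, for which
   nearest points need not exist; manifolds with boundary are excluded by
   [smooth_submanifold]. *)
Definition bounded_smooth_manifold {R : realType} {d : nat} (k : nat)
    (Sigma : set 'rV[R]_d) : Prop :=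
  [/\ smooth_submanifold k Sigma, closed Sigma & bounded_set Sigma].

(* velocities at p of the smooth curves in Sigma through p *)
Definition tangent_vector {R : realType} {d : nat} (Sigma : set 'rV[R]_d)
    (p v : 'rV[R]_d) : Prop :=
  exists (e : R) (g : R -> 'rV[R]_d),
  [/\ 0 < e, smooth_on `]- e, e[%classic g,
      (forall t : R, - e < t < e -> Sigma (g t)),
      g 0 = p & 'D_1 g 0 = v].

Definition tangent_flat {R : realType} {d : nat} (Sigma : set 'rV[R]_d)
    (p : 'rV[R]_d) : set 'rV[R]_d :=
  [set p + v | v in tangent_vector Sigma p].

Definition normal_flat {R : realType} {d : nat} (Sigma : set 'rV[R]_d)
    (p : 'rV[R]_d) : set 'rV[R]_d :=
  [set q | forall y, tangent_flat Sigma p y -> dot (q - p) (y - p) = 0].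

Definition nearest_point {R : realType} {d : nat} (Sigma : set 'rV[R]_d)
    (x p : 'rV[R]_d) : Prop :=
  Sigma p /\ forall q, Sigma q -> eucl_dist x p <= eucl_dist x q.

Definition medial_axis {R : realType} {d : nat} (Sigma : set 'rV[R]_d)
    : set 'rV[R]_d :=
  closure [set y | exists p q,
    [/\ p != q, nearest_point Sigma y p & nearest_point Sigma y q]].

(* The medial axis is closed, so the infima below are minima whenever they range
   over a nonempty set. On the empty set (e.g. if Sigma is a single point) [inf]
   is 0; a hypothesis r < ebs Sigma p or r < lfs Sigma p with 0 <= r then never
   holds. *)
Definition lfs {R : realType} {d : nat} (Sigma : set 'rV[R]_d) (p : 'rV[R]_d)
    : R :=
  inf [set eucl_dist p m | m in medial_axis Sigma].

Definition ebs {R : realType} {d : nat} (Sigma : set 'rV[R]_d) (p : 'rV[R]_d)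
    : R :=
  inf [set eucl_dist p m | m in medial_axis Sigma `&` normal_flat Sigma p].

Definition affinely_independent {R : realType} {d n : nat}
    (v : 'I_n.+1 -> 'rV[R]_d) : Prop :=
  forall a : 'I_n.+1 -> R,
  \sum_i a i = 0 -> \sum_i a i *: v i = 0 -> forall i, a i = 0.

Definition simplex {R : realType} {d n : nat} (v : 'I_n.+1 -> 'rV[R]_d)
    : set 'rV[R]_d :=
  [set x | exists a : 'I_n.+1 -> R,
    [/\ forall i, 0 <= a i, \sum_i a i = 1 & x = \sum_i a i *: v i]].

Definition circumscribes {R : realType} {d n : nat} (c : 'rV[R]_d) (r : R)
    (v : 'I_n.+1 -> 'rV[R]_d) : Prop :=
  forall i, eucl_dist c (v i) = r.

(* Main.v *)
(* Let e be ebs or lfs at the nearest point p of x. The ray from p through x can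
   only stop having p as nearest point at a point of the medial axis, so the open
   ball B of radius e tangent to Sigma at p, on the side of x, misses Sigma. The
   difference of the power functions of B and of B_tau is affine and nonnegative
   at the vertices of tau, hence nonnegative at x; since |x p| <= r < e, this is
   the first inequality. For the sharpness statement Sigma is a unit k-sphere,
   whose medial axis is the orthogonal complement of its span. *)

Require Import Defs.
From HB Require Import structures.
From mathcomp Require Import all_boot all_order all_algebra.
From mathcomp Require Import all_classical all_reals all_analysis.
From mathcomp Require Import ring lra.
Import Order.TTheory GRing.Theory Num.Theory.
Import numFieldNormedType.Exports.
Local Open Scope classical_set_scope.
Local Open Scope ring_scope.

(** * Euclidean geometry *)

Section Euclid.
Context {R : realType} {d : nat}.
Implicit Types (u v w x y p q m : 'rV[R]_d) (a b : R).

(** Both chains come from a single statement about a radius [e] that is at most the distance from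
    [p] to every medial point having [p] as a nearest point. For [lfs] this is immediate. For [ebs]
    it needs such a medial point to lie in the normal flat, which holds because the squared distance
    to it is stationary at [p] along every curve of [Sigma]. The hard step is that the ray stops
    only on the medial axis: off the axis, uniqueness of nearest points has to be turned into a
    longer segment on which [p] stays nearest. Equality on the sphere has a simple source: the two
    power functions vanish at every vertex, so their affine difference is zero at [x] instead of
    merely nonnegative. *)

Lemma dotC u v : dot u v = dot v u.
Proof. by apply: eq_bigr => i _; rewrite mulrC. Qed.

Lemma dotDl u v w : dot (u + v) w = dot u w + dot v w.
Proof. by rewrite -big_split; apply: eq_bigr => i _; rewrite mxE mulrDl. Qed.

Lemma dotZl a u v : dot (a *: u) v = a * dot u v.
Proof. by rewrite /dot mulr_sumr; apply: eq_bigr => i _; rewrite mxE mulrA. Qed.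

Lemma dotDr u v w : dot u (v + w) = dot u v + dot u w.
Proof. by rewrite dotC dotDl !(dotC u). Qed.

Lemma dotZr a u v : dot u (a *: v) = a * dot u v.
Proof. by rewrite dotC dotZl dotC. Qed.

Lemma dotNl u v : dot (- u) v = - dot u v.
Proof. by rewrite -scaleN1r dotZl mulN1r. Qed.

Lemma dotNr u v : dot u (- v) = - dot u v.
Proof. by rewrite dotC dotNl dotC. Qed.

Lemma dot0l v : dot 0 v = 0.
Proof. by rewrite -(scale0r v) dotZl mul0r. Qed.

Lemma dot0r v : dot v 0 = 0.
Proof. by rewrite dotC dot0l. Qed.

Definition dotE := (dotDl, dotDr, dotZl, dotZr, dotNl, dotNr, dot0l, dot0r).

Lemma dot_suml (I : finType) (F : I -> 'rV[R]_d) v :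
  dot (\sum_i F i) v = \sum_i dot (F i) v.
Proof.
by elim/big_rec2: _ => [|i a u _ <-]; rewrite ?dot0l ?dotDl.
Qed.

Lemma dot_ge0 u : 0 <= dot u u.
Proof. by apply: sumr_ge0 => i _; rewrite -expr2 sqr_ge0. Qed.

Lemma sqr_coord_le_dot u i : u 0 i ^+ 2 <= dot u u.
Proof.
rewrite /dot (bigD1 i) //= -expr2 lerDl.
by apply: sumr_ge0 => j _; rewrite -expr2 sqr_ge0.
Qed.

Lemma dot_eq0 u : (dot u u == 0) = (u == 0).
Proof.
apply/idP/eqP => [/eqP u0|->]; last by rewrite dot0l.
apply/rowP => i; apply/eqP; rewrite mxE -sqrf_eq0 eq_le sqr_ge0 andbT.
by rewrite -u0 sqr_coord_le_dot.
Qed.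

Lemma dot_gt0 u : (0 < dot u u) = (u != 0).
Proof. by rewrite lt_def dot_ge0 dot_eq0 andbT. Qed.

Lemma cauchy_schwarz u v : dot u v ^+ 2 <= dot u u * dot v v.
Proof.
have [->|v0] := eqVneq v 0; first by rewrite !dot0r mulr0 expr0n.
have := dot_ge0 (dot v v *: u - dot u v *: v).
rewrite !dotE (dotC v u) => h.
have {h}: 0 <= dot v v * (dot u u * dot v v - dot u v ^+ 2) by lra.
by rewrite pmulr_rge0 ?dot_gt0// subr_ge0.
Qed.

Lemma dist_ge0 p q : 0 <= eucl_dist p q.
Proof. exact: sqrtr_ge0. Qed.

Lemma sqr_dist p q : eucl_dist p q ^+ 2 = dot (p - q) (p - q).
Proof. by rewrite sqr_sqrtr ?dot_ge0. Qed.

Lemma distxx p : eucl_dist p p = 0.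
Proof. by rewrite /eucl_dist subrr dot0l sqrtr0. Qed.

Lemma distC p q : eucl_dist p q = eucl_dist q p.
Proof. by rewrite /eucl_dist -opprB dotNl dotNr opprK. Qed.

Lemma sqrt_dotZ a u :
  Num.sqrt (dot (a *: u) (a *: u)) = `|a| * Num.sqrt (dot u u).
Proof. by rewrite dotZl dotZr mulrA -expr2 sqrtrM ?sqr_ge0// sqrtr_sqr. Qed.

Lemma ler_dist p q a : 0 <= a ->
  (eucl_dist p q <= a) = (dot (p - q) (p - q) <= a ^+ 2).
Proof. by move=> a0; rewrite -sqr_dist ler_sqr ?nnegrE ?dist_ge0. Qed.

Lemma ler_dist2 p q p' q' :
  (eucl_dist p q <= eucl_dist p' q') =
  (dot (p - q) (p - q) <= dot (p' - q') (p' - q')).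
Proof. by rewrite ler_dist ?dist_ge0// sqr_dist. Qed.

Lemma dist_triangle x y z : eucl_dist x z <= eucl_dist x y + eucl_dist y z.
Proof.
rewrite ler_dist ?addr_ge0 ?dist_ge0//.
have -> : x - z = (x - y) + (y - z) by rewrite addrA subrK.
rewrite -subr_ge0 sqrrD !sqr_dist; move: (cauchy_schwarz (x - y) (y - z)).
rewrite [dot (_ + (y - z)) _]dotDl ![dot _ (_ + (y - z))]dotDr.
rewrite (dotC (y - z) (x - y)) -!sqr_dist -exprMn => cs; have /ler_normlP[_] :
    `|dot (x - y) (y - z)| <= eucl_dist x y * eucl_dist y z.
  by rewrite -ler_sqr ?nnegrE ?mulr_ge0 ?dist_ge0// real_normK ?num_real.
lra.
Qed.

Lemma cvg_dot (T : Type) (F : set_system T) {FF : Filter F}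
    (f g : T -> 'rV[R]_d) u v :
  f t @[t --> F] --> u -> g t @[t --> F] --> v ->
  dot (f t) (g t) @[t --> F] --> dot u v.
Proof.
move=> fu gv; apply: (cvg_big add_continuous) => i _.
have coord (h : T -> 'rV[R]_d) w : h t @[t --> F] --> w ->
    h t 0 i @[t --> F] --> w 0 i.
  move=> hw; apply: (@cvg_comp _ _ _ h (fun z => z 0 i) _ _ _ hw).
  exact: coord_continuous.
by apply: cvgM; exact: coord.
Qed.

Lemma continuous_dist p : continuous (eucl_dist p).
Proof.
move=> y; have FF := nbhs_filter (y : 'rV[R]_d).
have py : p - z @[z --> y] --> p - y by exact: (cvgB (cvg_cst _) cvg_id).
have := @cvg_dot _ _ FF _ _ _ _ py py.
by move=> h; exact: (cvg_comp _ _ h (@sqrt_continuous R _)).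
Qed.

End Euclid.

(** * Nearest points *)

Section Nearest.
Context {R : realType} {d : nat}.
Implicit Types (S : set 'rV[R]_d) (u w x y p q m : 'rV[R]_d).

(** This comparison makes Euclidean balls bounded and puts a Euclidean ball inside every sup-norm
    ball; in the other direction [continuous_dist] suffices. *)
Lemma norm_le_dist p q : `|p - q| <= eucl_dist p q.
Proof.
rewrite [leLHS]/Num.norm /= mx_normrE; apply/bigmax_leP; split=> [|[i j] _ /=].
  exact: dist_ge0.
rewrite ord1 -ler_sqr ?nnegrE ?dist_ge0// real_normK ?num_real//.
by rewrite sqr_dist sqr_coord_le_dot.
Qed.

Lemma compact_cball p (e : R) : compact (cball p e).
Proof.
apply: bounded_closed_compact.
  exists (`|p| + e); split; first exact: num_real.
  move=> b eb y /= pye; apply: le_trans (ltW eb).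
  have -> : y = p - (p - y) by rewrite opprB addrC subrK.
  by rewrite (le_trans (ler_normB _ _))// lerD2l (le_trans (norm_le_dist _ _)).
have -> : cball p e = eucl_dist p @^-1` [set z | z <= e] by [].
by apply: preimage_closed (@closed_le R e) => y _; exact: continuous_dist.
Qed.

Lemma ex_nearest_point S y :
  compact S -> S !=set0 -> exists q, nearest_point S y q.
Proof.
move=> cS S0.
have [q + qmin] := compact_EVT_min S0 cS
  (continuous_subspaceT (@continuous_dist R d y)).
rewrite inE => Sq; exists q; split => // z Sz.
by apply: qmin; rewrite inE.
Qed.

(** For [y'] on the segment, [|y'z| >= |yz| - |yy'| >= |yq| - |yy'| = |y'q|]. *)
Lemma nearest_point_segment S y q (l : R) : 0 <= l <= 1 ->
  nearest_point S y q -> nearest_point S (y - l *: (y - q)) q.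
Proof.
move=> /andP[l0 l1] [Sq qmin]; split=> // z Sz.
have yz := le_trans (qmin _ Sz) (dist_triangle y (y - l *: (y - q)) z).
have yl : eucl_dist y (y - l *: (y - q)) = l * eucl_dist y q.
  by rewrite /eucl_dist opprB addrC subrK sqrt_dotZ ger0_norm.
have lq : eucl_dist (y - l *: (y - q)) q = (1 - l) * eucl_dist y q.
  rewrite -[1 - l]ger0_norm ?subr_ge0// /eucl_dist -sqrt_dotZ.
  by rewrite scalerBl scale1r addrAC.
by move: yz; rewrite yl lq; lra.
Qed.

(** On the compact set of points of [S] at distance at least [a] from [q], the distance to [y] has a
    minimum, which uniqueness makes larger than [|yq|]. Moving [y] by less than half of this gap
    cannot make such a point nearest. *)
Lemma nearest_point_continuous S y q : compact S -> nearest_point S y q ->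
    (forall q', nearest_point S y q' -> q' = q) ->
  forall a : R, 0 < a -> exists2 b : R, 0 < b &
    forall z q', eucl_dist y z < b -> nearest_point S z q' ->
    eucl_dist q q' < a.
Proof.
move=> cS [Sq qmin] quniq a a0.
pose C := S `&` eucl_dist q @^-1` [set b | a <= b].
have cC : compact C.
  apply: compact_closedI => //.
  by apply: preimage_closed (@closed_ge R a) => z _; exact: continuous_dist.
have [C0|/set0P/negP/negPn/eqP C0] := pselect (C !=set0); last first.
  exists 1 => // z q' _ [Sq' _]; rewrite ltNge; apply/negP => aq'.
  by have : C q' by []; rewrite C0.
have [q1 + q1min] := compact_EVT_min C0 cC
  (continuous_subspaceT (@continuous_dist R d y)).
rewrite inE => -[Sq1 aq1].
have yq : eucl_dist y q < eucl_dist y q1.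
  rewrite ltNge; apply/negP => q1q.
  have q1E : q1 = q.
    by apply: quniq; split=> // z Sz; exact: le_trans q1q (qmin _ Sz).
  by move: aq1; rewrite /= q1E distxx leNgt a0.
exists ((eucl_dist y q1 - eucl_dist y q) / 2); first by lra.
move=> z q' yz [Sq' q'min]; rewrite ltNge; apply/negP => aq'.
have := q1min q'; rewrite inE => /(_ (conj Sq' aq')).
have := dist_triangle y z q'; have := dist_triangle z y q.
have := q'min _ Sq; rewrite (distC z y); lra.
Qed.

End Nearest.

(** * Extension of normal segments up to the medial axis *)

Section MedialRay.
Context {R : realType} {d : nat}.
Implicit Types (S : set 'rV[R]_d) (u w x y p q m : 'rV[R]_d).

(** The closure in [medial_axis] yields uniqueness on a whole ball around [m]; halving its radius
    gives a closed ball, compact for the maximisation that follows. *)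
Lemma unique_nearest_near S m : ~ medial_axis S m ->
  exists2 e : R, 0 < e & forall y p q, eucl_dist m y <= e ->
    nearest_point S y p -> nearest_point S y q -> p = q.
Proof.
move=> mM; have : nbhs m (~` medial_axis S).
  apply: open_nbhs_nbhs; split=> //.
  by apply: closed_openC; exact: closed_closure.
move/nbhs_ballP => [e /= e0 eM]; exists (e / 2); first by rewrite divr_gt0.
move=> y p q my yp yq; apply/eqP/negPn/negP => pq.
apply: (eM y); last by apply: subset_closure; exists p, q.
rewrite -ball_normE /=; apply: le_lt_trans (norm_le_dist _ _) _; lra.
Qed.

(* The point y beyond m on the ray from p is found variationally: it maximises
   l * dist(y, S)^2 - |y - m|^2 over a small ball around m. Near m nearest points
   are unique, so the maximum is critical, which says y - m = l (y - q) for the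
   nearest point q of y; hence m lies on [y, q] and q = p. This replaces the
   gradient-flow (or Brouwer) argument for extending normal segments. *)
Lemma medial_axis_extend S m p : compact S -> nearest_point S m p -> m != p ->
  ~ medial_axis S m ->
  exists2 s : R, 0 < s & nearest_point S (m + s *: (m - p)) p.
Proof.
move=> cS mp mNp /unique_nearest_near[e e0 uniq].
have S0 : S !=set0 by exists p; case: mp.
have [pi piP] := boolp.choice (fun y => @ex_nearest_point R d S y cS S0).
pose f y := eucl_dist y (pi y).
have f_le y z : f y <= eucl_dist y z + f z.
  apply: le_trans (dist_triangle _ _ _).
  by have [_ ->//] := piP y; have [] := piP z.
have cf : continuous f.
  move=> y; have FF := nbhs_filter (y : 'rV[R]_d).
  apply/cvgrPdist_le => /= b b0.
  have /cvgrPdist_le/(_ _ b0) := @continuous_dist R d y y.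
  apply: filterS => z /=.
  rewrite distxx sub0r normrN ger0_norm ?dist_ge0// => yz.
  rewrite ler_norml lerBrDl lerBlDr.
  have := f_le y z; have := f_le z y; rewrite (distC z y); lra.
set D2 := dot (m - p) (m - p).
have D2_gt0 : 0 < D2 by rewrite dot_gt0 subr_eq0.
(* Where [|my| = e], [f y ^+ 2 <= 2 * e ^+ 2 + 2 * D2], so [psi y < psi m] as soon as
   [l * (2 * e ^+ 2 + D2) < e ^+ 2], and the maximum is interior. This [l] is half the threshold and
   is also below 1. *)
pose l : R := e ^+ 2 / (2 * (2 * e ^+ 2 + D2)).
have e2 : 0 < e ^+ 2 by rewrite exprn_gt0.
have lE : l * (2 * e ^+ 2 + D2) = e ^+ 2 / 2 by rewrite /l; field; lra.
have l0 : 0 < l by rewrite divr_gt0//; lra.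
have l1 : l < 1 by rewrite ltr_pdivrMr; lra.
pose psi y := l * f y ^+ 2 - eucl_dist m y ^+ 2.
have cpsi : continuous psi.
  move=> y; have FF := nbhs_filter (y : 'rV[R]_d).
  have cd := @continuous_dist R d m y.
  exact: (cvgB (cvgM (cvg_cst l) (cvgM (cf y) (cf y))) (cvgM cd cd)).
have [|y + ymax] := compact_EVT_max _ (compact_cball m e)
  (continuous_subspaceT cpsi).
  by exists m; rewrite /cball/= distxx ltW.
rewrite inE /cball /= => mye.
have {}ymax z : eucl_dist m z <= e -> psi z <= psi y.
  by move=> mz; apply: ymax; rewrite inE.
have fm : f m ^+ 2 = D2.
  rewrite /f (uniq m (pi m) p) ?sqr_dist ?distxx//; exact: ltW.
have my_lt : eucl_dist m y < e.
  rewrite lt_def mye andbT; apply/eqP => /esym my_eq.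
  have := ymax m; rewrite distxx => /(_ (ltW e0)).
  rewrite /psi fm distxx expr0n /= subr0 my_eq.
  have : f y ^+ 2 <= 2 * e ^+ 2 + 2 * D2.
    have fyp : f y <= eucl_dist y p by have [_ ->//] := piP y; case: mp.
    apply: (@le_trans _ _ (eucl_dist y p ^+ 2)).
      by rewrite ler_sqr ?nnegrE ?dist_ge0.
    rewrite -my_eq (distC m y) !sqr_dist -subr_ge0.
    have := dot_ge0 ((y - m) - (m - p)).
    have -> : y - p = (y - m) + (m - p) by rewrite addrA subrK.
    rewrite /D2; move: (y - m) (m - p) => a b.
    by rewrite !dotE (dotC b a); lra.
  move=> fy; have : l * f y ^+ 2 <= l * (2 * e ^+ 2 + 2 * D2).
    by rewrite ler_pM2l.
  lra.
set q := pi y; have yq : nearest_point S y q := piP y.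
have yuniq q' : nearest_point S y q' -> q' = q.
  by move=> yq'; exact: (uniq y).
(* Formally half the gradient of [psi] at [y]. Differentiability of [f ^+ 2] is avoided: if [q'] is
   nearest to [z], then [f z ^+ 2 - f y ^+ 2 >= |zq'|^2 - |yq'|^2], and [q'] is close to [q]. *)
set w := l *: (y - q) - (y - m).
have w0 : w = 0.
  apply/eqP/negPn/negP => w_neq0.
  pose n := Num.sqrt (dot w w).
  have n2 : n ^+ 2 = dot w w by rewrite sqr_sqrtr ?dot_ge0.
  have n0 : 0 < n by rewrite sqrtr_gt0 dot_gt0.
  have n02 : 0 < n / 2 by rewrite divr_gt0.
  have [b b0 near_q] := nearest_point_continuous S y q cS yq yuniq _ n02.
  (* The step from [y] along [w] must stay strictly shorter than [b] for [near_q], and [z] must stay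
     in the ball where [y] is maximal. *)
  pose c := Num.min (b / 2) (e - eucl_dist m y).
  have c0 : 0 < c by rewrite lt_min divr_gt0//= subr_gt0.
  have [cb ce] : c <= b / 2 /\ c <= e - eucl_dist m y.
    by rewrite /c; split; rewrite ge_min lexx ?orbT.
  pose t := Num.min 1 (c / n).
  have t0 : 0 < t by rewrite lt_min ltr01 divr_gt0.
  have t1 : t <= 1 by rewrite /t ge_min lexx.
  have tn : t * n <= c by rewrite -ler_pdivlMr// /t ge_min lexx orbT.
  pose z := y + t *: w.
  have yz : eucl_dist y z = t * n.
    rewrite /eucl_dist /z opprD addrA subrr add0r dotNl dotNr opprK.
    by rewrite sqrt_dotZ gtr0_norm.
  have mz : eucl_dist m z <= e.
    by apply: le_trans (dist_triangle m y z) _; rewrite yz; lra.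
  have zq' := piP z; set q' := pi z in zq'.
  have qq' : eucl_dist q q' < n / 2 by apply: near_q zq'; rewrite yz; lra.
  have dwq : - (dot w w / 2) <= dot w (q - q').
    have cs := cauchy_schwarz w (q - q').
    suff /ler_normlP[] : `|dot w (q - q')| <= dot w w / 2 by lra.
    rewrite -ler_sqr ?nnegrE ?divr_ge0 ?dot_ge0// real_normK ?num_real//.
    apply: le_trans cs _; rewrite expr_div_n -sqr_dist expr2 -mulrA.
    rewrite ler_pM2l ?dot_gt0// -n2 -expr_div_n.
    by rewrite ler_sqr ?nnegrE ?dist_ge0 ?ltW.
  have := ymax z mz; rewrite /psi {1}/f -/q'.
  have : l * f y ^+ 2 <= l * eucl_dist y q' ^+ 2.
    rewrite ler_pM2l// ler_sqr ?nnegrE ?dist_ge0//.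
    by have [_ ->//] := yq; case: zq'.
  rewrite (distC m z) (distC m y) !sqr_dist.
  have -> : z - q' = (y - q) + (q - q') + t *: w.
    by rewrite addrA subrK addrAC.
  have -> : z - m = (y - m) + t *: w by rewrite addrAC.
  have -> : y - q' = (y - q) + (q - q') by rewrite addrA subrK.
  have ww : dot w w = l * dot w (y - q) - dot w (y - m).
    by rewrite {2}/w -dotZr -dotNr -dotDr.
  have W0 : 0 < dot w w by rewrite dot_gt0.
  move: dwq ww W0; rewrite -/w; move: (y - q) (q - q') (y - m) => a a' b'.
  clearbody w; rewrite !dotE !(dotC _ w) => dwq ww W0 h1 h2.
  (* Maximality of [y] tested at [z], divided by [t]. With [t <= 1] it forces
     [(2 - l) * dot w w <= (1 - l) * dot w w]. *)
  have h : 2 * (dot w w + l * dot w a') <= t * ((1 - l) * dot w w).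
    rewrite -(ler_pM2l t0) {1}ww; lra.
  have h3 : l * - (dot w w / 2) <= l * dot w a' by rewrite ler_pM2l.
  have h4 : t * ((1 - l) * dot w w) <= (1 - l) * dot w w.
    by rewrite ler_piMl// mulr_ge0 ?dot_ge0//; lra.
  have h5 : 0 < l * dot w w by rewrite mulr_gt0.
  lra.
have ym : y - m = l *: (y - q).
  by apply/eqP; rewrite -subr_eq0 -oppr_eq0 opprB -/w w0.
have qp : q = p.
  apply: (uniq m) => //; first by rewrite distxx ltW.
  suff -> : m = y - l *: (y - q).
    by apply: nearest_point_segment => //; rewrite !ltW.
  by rewrite -ym opprB addrC subrK.
have l1' : 1 - l != 0 by lra.
(* [m] divides the segment from [y] to [p] in the ratio [l : 1 - l]. *)
exists (l / (1 - l)); first by rewrite divr_gt0//; lra.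
suff -> : m + (l / (1 - l)) *: (m - p) = y by rewrite -qp.
have mE : m - p = (1 - l) *: (y - p).
  by rewrite scalerBl scale1r -qp -ym opprB [RHS]addrC addrA subrK.
by rewrite mE scalerA divfK// -qp -ym addrC subrK.
Qed.

(* The set of t such that p is nearest to p + t (x - p) is closed; by the previous
   lemma its supremum, if finite, gives a point of the medial axis. *)
Lemma nearest_point_ray S x p (e : R) : compact S -> nearest_point S x p ->
    x != p ->
    (forall m, medial_axis S m -> nearest_point S m p -> e <= eucl_dist p m) ->
  forall t : R, 0 <= t -> t * eucl_dist x p <= e ->
    nearest_point S (p + t *: (x - p)) p.
Proof.
move=> cS xp xNp eM t t0 te; apply: contrapT => tp.
set u := x - p in tp *; have u_neq0 : u != 0 by rewrite subr_eq0.
have Sp : S p by case: xp.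
pose A := [set a : R | 0 <= a /\ nearest_point S (p + a *: u) p].
(* The terms quadratic in [a] cancel between the squared distances, leaving for each [q] a condition
   linear in [a]. Downward closure and membership of the supremum follow by arithmetic. *)
have AP a : 0 <= a ->
    A a <-> (forall q, S q -> a * (2 * dot u (q - p)) <= dot (q - p) (q - p)).
  move=> a0.
  have h q : (eucl_dist (p + a *: u) p <= eucl_dist (p + a *: u) q) =
      (a * (2 * dot u (q - p)) <= dot (q - p) (q - p)).
    rewrite ler_dist2 [p + _ - p]addrAC subrr add0r.
    have -> : p + a *: u - q = a *: u - (q - p).
      by rewrite opprB addrA [a *: u + p]addrC.
    move: (q - p) (u) => v w; rewrite !dotE (dotC v w); apply/idP/idP; lra.
  split=> [[_ [_ aq]] q Sq|aq]; first by rewrite -h aq.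
  by split=> //; split=> // q Sq; rewrite h aq.
have A1 : A 1 by split=> //; rewrite scale1r /u addrC subrK.
have Ale a b : A a -> 0 <= b -> b <= a -> A b.
  move=> Aa b0 ba; have a0 : 0 <= a by case: Aa.
  apply/(AP _ b0) => q Sq; have [uq|uq] := leP 0 (dot u (q - p)).
    apply: le_trans ((AP _ a0).1 Aa _ Sq); rewrite ler_wpM2r//; lra.
  apply: le_trans (dot_ge0 _).
  by rewrite mulr_ge0_le0//; lra.
have ubA : ubound A t.
  move=> a Aa; rewrite leNgt; apply/negP => ta; apply: tp.
  by case: (Ale a t Aa t0 (ltW ta)).
have supA : has_sup A by split; [exists 1|exists t].
set T := sup A.
have T1 : 1 <= T by exact: sup_upper_bound.
have Tt : T <= t by apply: sup_le_ub => //; exists 1.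
have AT : A T.
  have T0 : 0 <= T by lra.
  apply/(AP _ T0) => q Sq; have [uq|uq] := leP (dot u (q - p)) 0.
    by apply: le_trans (dot_ge0 _); rewrite mulr_ge0_le0//; lra.
  have uq2 : 0 < 2 * dot u (q - p) by lra.
  rewrite -ler_pdivlMr//; apply: sup_le_ub; first by exists 1.
  by move=> a Aa; rewrite ler_pdivlMr//; apply: (AP a _).1 => //; case: Aa.
have {}Tt : T < t.
  rewrite lt_neqAle Tt andbT; apply/eqP => TtE.
  by apply: tp; rewrite -TtE; case: AT.
have dT : eucl_dist p (p + T *: u) = T * eucl_dist x p.
  rewrite distC /eucl_dist addrAC subrr add0r -/u sqrt_dotZ.
  by rewrite ger0_norm//; lra.
have xp0 : 0 < eucl_dist x p by rewrite sqrtr_gt0 dot_gt0.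
have [s s0 sp] : exists2 s : R, 0 < s &
    nearest_point S (p + T *: u + s *: (p + T *: u - p)) p.
  apply: medial_axis_extend => //; first by case: AT.
    rewrite -subr_eq0 addrAC subrr add0r scaler_eq0 negb_or u_neq0 andbT; lra.
  move=> TM; have := eM _ TM; rewrite dT => /(_ AT.2) eT.
  by have : T * eucl_dist x p < t * eucl_dist x p; [rewrite ltr_pM2r|lra].
have : A (T + s * T).
  split; first by nra.
  by move: sp; rewrite [p + _ - p]addrAC subrr add0r scalerA -addrA -scalerDl.
move/(sup_upper_bound supA); rewrite -/T; nra.
Qed.

End MedialRay.

(** * The enclosing-ball inequality *)

Section Normal.
Context {R : realType} {d : nat}.
Implicit Types (S : set 'rV[R]_d) (m p : 'rV[R]_d).

Lemma is_derive_dot (V : normedModType R) (f g : V -> 'rV[R]_d) x w df dg :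
  is_derive x w f df -> is_derive x w g dg ->
  is_derive x w (fun y => dot (f y) (g y)) (dot (f x) dg + dot df (g x)).
Proof.
move=> fd gd.
have coord (h : V -> 'rV[R]_d) dh i :
    is_derive x w h dh -> is_derive x w (fun y => h y 0 i) (dh 0 i).
  move=> hd; have dhx : derivable h x w by case: hd.
  apply: DeriveDef; first by have /derivable_mxP/(_ 0 i) := dhx.
  by case: hd => _ <-; rewrite derive_mx// mxE.
rewrite (_ : (fun y => _) =
    \sum_(i < d) ((fun y => f y 0 i) * (fun y => g y 0 i))); last first.
  by apply/funext => y; rewrite fct_sumE.
have dfg i := is_deriveM (coord _ _ i fd) (coord _ _ i gd).
apply: (is_derive_eq (is_derive_sum dfg)).
by rewrite big_split; congr (_ + _); apply: eq_bigr => i _; rewrite //= mulrC.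
Qed.

Lemma nearest_point_normal S m p : nearest_point S m p -> normal_flat S p m.
Proof.
move=> [Sp pmin] _ [w [e [g [e0 gsmooth gS g0 gw]]] <-].
have [dg _] := gsmooth 1%N.
have g_in (t : R) : t \in `]- e, e[%R -> is_derive t 1 g ('D_1 g t).
  by move=> te; apply: derivableP; apply: diff_derivable; exact: dg.
pose F (t : R) := dot (m - g t) (m - g t).
have dF (t : R) : t \in `]- e, e[%R ->
    is_derive t 1 F (dot (m - g t) (- 'D_1 g t) + dot (- 'D_1 g t) (m - g t)).
  move=> /g_in gt.
  have mg : is_derive t 1 (fun s => m - g s) (- 'D_1 g t).
    apply: (is_derive_eq (is_deriveB (is_derive_cst m t 1) gt)).
    by rewrite sub0r.
  exact: is_derive_dot.
have e_0 : 0 \in `]- e, e[%R by rewrite in_itv /= e0 oppr_lt0 e0.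
have : is_derive (0 : R) 1 F 0.
  apply: (@derive1_at_min _ F (- e) e 0) => //; first by lra.
    by move=> t /dF [].
  move=> t te; rewrite /F g0 -ler_dist2; apply: pmin; apply: gS.
  by move: te; rewrite in_itv.
have := dF _ e_0; rewrite g0 gw => -[_ F1] [_ F2].
by move: F1; rewrite F2 addrAC subrr add0r dotNl dotNr (dotC w); lra.
Qed.

End Normal.

Section Simplex.
Context {R : realType} {d n : nat}.
Variable v : 'I_n.+1 -> 'rV[R]_d.

Lemma simplex_vertex i : simplex v (v i).
Proof.
exists (fun j => (j == i)%:R); split=> [j| |]; first exact: ler0n.
  by rewrite (bigD1 i)//= eqxx big1 ?addr0// => j /negbTE ->.
rewrite (bigD1 i)//= eqxx scale1r big1 ?addr0// => j /negbTE ->.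
by rewrite scale0r.
Qed.

(* Leibniz' formula. Subtracting two instances, for two values of [z], shows that
   a difference of two power functions is affine. *)
Lemma sum_sqr_dist_simplex (a : 'I_n.+1 -> R) x z :
  \sum_i a i = 1 -> x = \sum_i a i *: v i ->
  \sum_i a i * eucl_dist (v i) z ^+ 2 =
    eucl_dist x z ^+ 2 + \sum_i a i * eucl_dist (v i) x ^+ 2.
Proof.
move=> a1 xE.
have c0 : \sum_i a i *: (v i - x) = 0.
  under eq_bigr do rewrite scalerBr.
  by rewrite sumrB -xE -scaler_suml a1 scale1r subrr.
have -> : eucl_dist x z ^+ 2 = \sum_i a i * eucl_dist x z ^+ 2.
  by rewrite -mulr_suml a1 mul1r.
have cross0 : \sum_i a i * (2 * dot (v i - x) (x - z)) = 0.
  transitivity (2 * dot (\sum_i a i *: (v i - x)) (x - z)).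
    rewrite dot_suml mulr_sumr; apply: eq_bigr => i _.
    by rewrite [dot (_ *: _) _]dotZl mulrCA.
  by rewrite c0 dot0l mulr0.
rewrite -[RHS]addr0 -[in X in _ = _ + X]cross0 -!big_split /=.
apply: eq_bigr => i _.
rewrite !sqr_dist; have -> : v i - z = (v i - x) + (x - z) by rewrite addrA subrK.
move: (v i - x) (x - z) => b c; rewrite !dotE (dotC c b); ring.
Qed.

(** The last hypothesis is the property shared by [ebs S xt] and [lfs S xt], so one proof serves
    both chains. *)
Lemma dist_nearest_le_ball S c (r e : R) x xt : compact S ->
  (forall i, S (v i)) -> simplex v `<=` cball c r -> simplex v x ->
  nearest_point S x xt -> r < e ->
  (forall m, medial_axis S m -> nearest_point S m xt -> e <= eucl_dist xt m) ->
  eucl_dist x xt <= e - Num.sqrt (e ^+ 2 - r ^+ 2 + eucl_dist x c ^+ 2).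
Proof.
move=> cS vS vcr vx near_xt re eM.
have xc : eucl_dist x c <= r by rewrite distC; exact: vcr.
have r0 : 0 <= r := le_trans (dist_ge0 x c) xc.
have e0 : 0 < e := le_lt_trans r0 re.
have [a [a_ge0 a1 xE]] := vx.
have sum_c : \sum_i a i * eucl_dist (v i) c ^+ 2 <= r ^+ 2.
  rewrite -[leRHS]mul1r -a1 mulr_suml ler_sum// => i _.
  rewrite ler_wpM2l// ler_sqr ?nnegrE ?dist_ge0// distC.
  exact/vcr/simplex_vertex.
set t := eucl_dist x xt; have t0 : 0 <= t := dist_ge0 _ _.
have sum_x : t ^+ 2 <= \sum_i a i * eucl_dist (v i) x ^+ 2.
  rewrite -[leLHS]mul1r -a1 mulr_suml ler_sum// => i _.
  rewrite ler_wpM2l// ler_sqr ?nnegrE ?dist_ge0// (distC _ x).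
  by have [_ ->] := near_xt.
have xc2 : eucl_dist x c ^+ 2 <= r ^+ 2 by rewrite ler_sqr ?nnegrE ?dist_ge0.
(* Every vertex is at distance at least [t] from [x], while Leibniz' formula about [c] bounds the
   weighted mean of these squared distances by [r^2 - |xc|^2]. *)
have tr : t <= r.
  rewrite -ler_sqr ?nnegrE//; have := sum_sqr_dist_simplex _ _ c a1 xE.
  have := sqr_ge0 (eucl_dist x c); lra.
suff h : e ^+ 2 - r ^+ 2 + eucl_dist x c ^+ 2 <= (e - t) ^+ 2.
  rewrite lerBrDl -lerBrDr -[leRHS]ger0_norm ?subr_ge0; last lra.
  by rewrite -sqrtr_sqr ler_wsqrtr.
(* If [x] lies on [S] the ray has no direction, but the claim is then just [|xc| <= r]. *)
have [xxt|xxt] := eqVneq x xt.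
  by rewrite /t xxt distxx subr0; rewrite -xxt; lra.
have t_gt0 : 0 < t by rewrite sqrtr_gt0 dot_gt0 subr_eq0.
(* Center of the empty ball of radius [e] touching [S] at [xt]. Leibniz' formula about [z] and about
   [c] gives [|xz|^2 - e^2 >= |xc|^2 - r^2]. *)
set z := xt + (e / t) *: (x - xt).
have zxt : nearest_point S z xt.
  apply: nearest_point_ray eM _ _ _ => //; first by rewrite divr_ge0// ltW.
  by rewrite divfK ?gt_eqF.
have ez : eucl_dist z xt = e.
  rewrite /eucl_dist /z addrAC subrr add0r sqrt_dotZ.
  rewrite ger0_norm ?divr_ge0 1?ltW// -/(eucl_dist x xt) -/t.
  by rewrite divfK ?gt_eqF.
have sum_z : e ^+ 2 <= \sum_i a i * eucl_dist (v i) z ^+ 2.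
  rewrite -[leLHS]mul1r -a1 mulr_suml ler_sum// => i _.
  rewrite ler_wpM2l// ler_sqr ?nnegrE ?dist_ge0 ?(ltW e0)//.
  rewrite (distC _ z) -[leLHS]ez.
  by have [_ ->] := zxt.
have xz : eucl_dist x z ^+ 2 = (e - t) ^+ 2.
  rewrite sqr_dist /z.
  have -> : x - (xt + (e / t) *: (x - xt)) = (1 - e / t) *: (x - xt).
    by rewrite scalerBl scale1r opprD addrA.
  rewrite dotZl dotZr mulrA -sqr_dist -/t.
  by field; rewrite gt_eqF.
have := sum_sqr_dist_simplex _ _ c a1 xE.
have := sum_sqr_dist_simplex _ _ z a1 xE; lra.
Qed.

End Simplex.

(** * Expansion of the square-root bound, and distances to the medial axis *)

Section Bounds.
Context {R : realType}.
Implicit Types e r b : R.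

Lemma sub_sqrt_le e r b :
  e - Num.sqrt (e ^+ 2 - r ^+ 2 + b ^+ 2) <= e - Num.sqrt (e ^+ 2 - r ^+ 2).
Proof. by rewrite lerB// ler_wsqrtr// lerDl sqr_ge0. Qed.

(** With [s] the square root, [r^2 = (e - s)(e + s)], so the error is exactly [(e - s)^2 / (2e)] and
    [r^4 = (e - s)^2 (e + s)^2]. The constant 1/2 comes from [e + s >= e], and is approached as [r]
    tends to [e]. *)
Lemma sub_sqrt_expansion e r : 0 <= r -> r < e ->
  `|e - Num.sqrt (e ^+ 2 - r ^+ 2) - r ^+ 2 / (2 * e)|
    <= 2^-1 * (r ^+ 4 / e ^+ 3).
Proof.
move=> r0 re; have e0 : 0 < e by lra.
have er : 0 <= e ^+ 2 - r ^+ 2 by rewrite subr_ge0 ler_sqr ?nnegrE; lra.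
set s := Num.sqrt _; have s0 : 0 <= s := sqrtr_ge0 _.
have s2 : s ^+ 2 = e ^+ 2 - r ^+ 2 by exact: sqr_sqrtr.
have rE : r ^+ 2 = e ^+ 2 - s ^+ 2 by lra.
have -> : e - s - r ^+ 2 / (2 * e) = (e - s) ^+ 2 / (2 * e).
  by rewrite rE; field; rewrite gt_eqF.
rewrite ger0_norm ?divr_ge0 ?sqr_ge0//; last by lra.
have -> : r ^+ 4 = (e - s) ^+ 2 * (e + s) ^+ 2.
  by rewrite -[4%N]/(2 * 2)%N exprM rE; ring.
rewrite -subr_ge0.
have -> : 2^-1 * ((e - s) ^+ 2 * (e + s) ^+ 2 / e ^+ 3) - (e - s) ^+ 2 / (2 * e)
    = (e - s) ^+ 2 * (s * (2 * e + s)) / (2 * e ^+ 3).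
  by field; rewrite gt_eqF.
have e3 : 0 < e ^+ 3 by rewrite exprn_gt0.
apply: divr_ge0; last lra.
by apply: mulr_ge0; [exact: sqr_ge0|apply: mulr_ge0; lra].
Qed.

Lemma lfs_le {d} (S : set 'rV[R]_d) p m :
  medial_axis S m -> lfs S p <= eucl_dist p m.
Proof.
move=> Mm; apply: ge_inf; last by exists m.
by exists 0 => _ [q _ <-]; exact: dist_ge0.
Qed.

Lemma ebs_le {d} (S : set 'rV[R]_d) p m :
  medial_axis S m -> nearest_point S m p -> ebs S p <= eucl_dist p m.
Proof.
move=> Mm /nearest_point_normal Nm; apply: ge_inf; last by exists m.
by exists 0 => _ [q _ <-]; exact: dist_ge0.
Qed.

End Bounds.

(** * Calculus of smooth maps *)

Section Smooth.
Context {R : realType}.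
Implicit Types V W : normedModType R.

Lemma near_eq_differentiable V W (f g : V -> W) x :
  {near x, f =1 g} -> differentiable f x -> differentiable g x.
Proof.
move=> fg df; have [cdf /eqaddoP dfo] := (diff_locallyP _ _).1 df.
have dgo : g \o shift x = cst (g x) + 'd f x +o_ 0 id.
  apply/eqaddoP => e e0; have := dfo _ e0.
  have : \forall y \near x, f y = g y by exact: fg.
  rewrite (near_shift (0 : V))/= subr0.
  apply: filterS2 => h /= fgh.
  by rewrite /= !fctE /= fgh (nbhs_singleton fg).
apply/diff_locallyP; rewrite (diff_unique cdf dgo); split => //.
Qed.

(** Differentiation rules hold only on [A], whereas ['D_v f] is a function on all of [V]; this lets
    a formula valid on [A] stand for it in the inductions below. *)
Lemma Cn_on_eq V W n (A : set V) (f g : V -> W) : open A ->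
  (forall x, A x -> f x = g x) -> Cn_on n A f -> Cn_on n A g.
Proof.
move=> oA; elim: n f g => [|n IH] f g fg.
  move=> cf x Ax; have fgx : f y @[y --> x] --> g x.
    by rewrite -(fg x Ax); exact: cf.
  apply: (cvg_trans _ fgx); apply: near_eq_cvg.
  by near=> y; apply: fg; near: y; exact: open_nbhs_nbhs.
have fg_near x : A x -> {near x, f =1 g}.
  by move=> Ax; near=> y; apply: fg; near: y; exact: open_nbhs_nbhs.
move=> [df Df]; split=> [x Ax|v].
  by apply: near_eq_differentiable (df x Ax); exact: fg_near.
apply: (IH ('D_v f)) (Df v) => x Ax.
by apply: near_eq_derive; exact: fg_near.
Unshelve. all: by end_near. Qed.

Lemma Cn_onW V W n (A : set V) (f : V -> W) : Cn_on n.+1 A f -> Cn_on n A f.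
Proof.
elim: n f => [f [df _] x Ax|n IH f [df Df]].
  exact: differentiable_continuous (df x Ax).
by split=> // v; exact/IH/Df.
Qed.

Lemma Cn_on_cst V W n (A : set V) (w : W) : Cn_on n A (fun=> w).
Proof.
elim: n w => [w x _|n IH w]; first exact: cvg_cst.
split=> [x _|v]; first exact: differentiable_cst.
suff -> : 'D_v (fun=> w) = (fun _ : V => 0 : W) by exact: IH.
by apply/funext => x; exact: derive_cst.
Qed.

Lemma Cn_onD V W n (A : set V) (f g : V -> W) : open A ->
  Cn_on n A f -> Cn_on n A g -> Cn_on n A (fun x => f x + g x).
Proof.
move=> oA; elim: n f g => [f g cf cg x Ax|n IH f g [df Df] [dg Dg]].
  exact: cvgD (cf x Ax) (cg x Ax).
split=> [x Ax|v]; first by apply: differentiableD; [exact: df|exact: dg].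
apply: (Cn_on_eq _ _ _ _ (fun x => 'D_v f x + 'D_v g x)) => //;
  last exact: (IH _ _ (Df v) (Dg v)).
move=> x Ax; rewrite -[RHS]/('D_v (f + g) x) deriveD//;
  by apply: diff_derivable; (exact: df || exact: dg).
Qed.

Lemma Cn_on_sum V W n (A : set V) (I : Type) (s : seq I) (f : I -> V -> W) :
  open A -> (forall i, Cn_on n A (f i)) ->
  Cn_on n A (fun x => \sum_(i <- s) f i x).
Proof.
move=> oA Cf; elim: s => [|i s IH].
  by under eq_fun do rewrite big_nil; exact: Cn_on_cst.
by under eq_fun do rewrite big_cons; exact: Cn_onD.
Qed.

Lemma Cn_onM V n (A : set V) (f g : V -> R) : open A ->
  Cn_on n A f -> Cn_on n A g -> Cn_on n A (fun x => f x * g x).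
Proof.
move=> oA; elim: n f g => [f g cf cg x Ax|n IH f g Cf Cg].
  exact: cvgM (cf x Ax) (cg x Ax).
have [[df Df] [dg Dg]] := (Cf, Cg).
split=> [x Ax|v]; first by apply: differentiableM; [exact: df|exact: dg].
apply: (Cn_on_eq _ _ _ _ (fun x => f x * 'D_v g x + g x * 'D_v f x)) => //.
  move=> x Ax; rewrite -[RHS]/('D_v (f * g) x) deriveM//;
    by apply: diff_derivable; (exact: df || exact: dg).
by apply: Cn_onD => //; apply: IH; (exact: Cn_onW || exact: Dg || exact: Df).
Qed.

Lemma Cn_onZl V W n (A : set V) (f : V -> R) (w : W) : open A ->
  Cn_on n A f -> Cn_on n A (fun x => f x *: w).
Proof.
move=> oA; elim: n f => [f cf x Ax|n IH f [df Df]].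
  exact: cvgZr_tmp (cf x Ax).
split=> [x Ax|v]; first by apply: differentiableZl; exact: df.
apply: (Cn_on_eq _ _ _ _ (fun x => 'D_v f x *: w)) => //;
  last exact: (IH _ (Df v)).
move=> x Ax; have dfx := df x Ax.
by rewrite [RHS]deriveE ?diffZl ?deriveE//; exact: differentiableZl.
Qed.

Lemma Cn_on_coord d n (A : set 'rV[R]_d) i :
  Cn_on n A (fun x : 'rV[R]_d => x 0 i).
Proof.
case: n => [x _|n]; first exact: coord_continuous.
split=> [x _|v]; first exact: differentiable_coord.
suff -> : 'D_v (fun x : 'rV[R]_d => x 0 i) = fun=> v 0 i by exact: Cn_on_cst.
apply/funext => x; have idx : derivable (@id 'rV[R]_d) x v.
  exact: derivable_id.
have := derive_mx idx.
by rewrite derive_id => /matrixP/(_ 0 i); rewrite mxE.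
Qed.

Lemma Cn_on_inv_sqrt V n (A : set V) (h : V -> R) : open A ->
  (forall x, A x -> 0 < h x) -> smooth_on A h ->
  Cn_on n A (fun x => (Num.sqrt (h x))^-1).
Proof.
move=> oA h0 Ch; elim: n => [x Ax|n IH].
  apply: cvgV; first by rewrite sqrtr_eq0 -ltNge h0.
  exact: (cvg_comp _ _ (Ch 0%N x Ax) (@sqrt_continuous R _)).
have dh x : A x -> differentiable h x by case: (Ch 1%N) => dh _; exact: dh.
pose w x := (Num.sqrt (h x))^-1.
have sq_neq0 x : A x -> Num.sqrt (h x) != 0.
  by move=> Ax; rewrite sqrtr_eq0 -ltNge h0.
have dsqrt x : A x -> is_derive (h x) 1 Num.sqrt (2 * Num.sqrt (h x))^-1.
  by move=> /h0; exact: is_derive1_sqrt.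
have dsq x : A x -> differentiable (Num.sqrt \o h) x.
  move=> Ax; apply: differentiable_comp; first exact: dh.
  by apply/derivable1_diffP; case: (dsqrt x Ax).
split=> [x Ax|v].
  by apply: (@differentiableV _ _ (Num.sqrt \o h)); [exact: dsq|exact: sq_neq0].
(* The derivative of [w] is [-1/2 w^3 'D_v h], so the induction hypothesis on [w] applies to each
   factor [w]. *)
apply: (Cn_on_eq _ _ _ _
  (fun x => - 2^-1 * (w x * (w x * (w x * 'D_v h x))))) => //; last first.
  have [_ Dh] := Ch n.+1.
  by do ![apply: Cn_onM => //]; (exact: Cn_on_cst || exact: IH || exact: Dh).
move=> x Ax; rewrite [RHS](@deriveV _ _ (Num.sqrt \o h)) ?sq_neq0//; last first.
  exact/diff_derivable/dsq.
have dsx : differentiable Num.sqrt (h x).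
  by apply/derivable1_diffP; case: (dsqrt x Ax).
rewrite [in RHS]deriveE; last exact: dsq.
rewrite diff_comp//=; last exact: dh.
rewrite -(@deriveE _ _ _ h x v (dh x Ax)).
rewrite -['D_v h x]mulr1 -[_ * 1]/(_ *: 1) linearZ -deriveE//.
have -> : 'D_1 Num.sqrt (h x) = (2 * Num.sqrt (h x))^-1 by case: (dsqrt x Ax).
have key (s D : R) : s != 0 ->
    - 2^-1 * (s^-1 * (s^-1 * (s^-1 * (D * 1)))) = - s ^- 2 * (D / (2 * s)).
  by move=> s0; field.
exact: (key _ _ (sq_neq0 x Ax)).
Qed.

End Smooth.

(** * The k-sphere *)

(** Indices start at 0, so the [k + 1] coordinates up to [k] are free; for [k = 0] and [d > 0] this
    is a pair of antipodal points. *)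
Definition sphere (R : realType) (d k : nat) : set 'rV[R]_d :=
  [set x | dot x x = 1 /\ forall i : 'I_d, (k < i)%N -> x 0 i = 0].

Section SphereManifold.
Context {R : realType} {d k : nat}.
Hypothesis kd : (k <= d)%N.
Local Notation S := (sphere R d.+1 k).

Lemma continuous_sqnorm n : continuous (fun x : 'rV[R]_n => dot x x).
Proof.
move=> x; have FF := nbhs_filter (x : 'rV[R]_n).
exact: (@cvg_dot _ _ _ _ FF id id x x cvg_id cvg_id).
Qed.

Lemma closed_sphere : closed S.
Proof.
have -> : S = (fun x => dot x x) @^-1` [set b | b = 1] `&`
    \bigcap_(i in [set i : 'I_d.+1 | (k < i)%N])
      (fun x : 'rV[R]_d.+1 => x 0 i) @^-1` [set b | b = 0].
  by apply/seteqP; split=> x [x1 xk]; split=> // i; exact: xk.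
apply: closedI.
  apply: preimage_closed (@closed_eq R 1) => x _.
  exact: continuous_sqnorm.
apply: closed_bigI => i _; apply: preimage_closed (@closed_eq R 0) => x _.
exact: coord_continuous.
Qed.

Lemma dist0 n (x : 'rV[R]_n) : eucl_dist x 0 = Num.sqrt (dot x x).
Proof. by rewrite /eucl_dist subr0. Qed.

Lemma bounded_sphere : bounded_set S.
Proof.
exists 1; split=> [|b b1 x [x1 _]]; first exact: num_real.
have := norm_le_dist x 0; rewrite subr0 dist0 x1 sqrtr1 => h.
exact: le_trans h (ltW b1).
Qed.

(* [chart_index j] enumerates the indices in {0..k} other than j. *)
Definition chart_index (j : 'I_d.+1) (i : 'I_k) : 'I_d.+1 :=
  lift j (widen_ord kd i).

Lemma chart_index_inj j : injective (chart_index j).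
Proof. by move=> a b /lift_inj /(congr1 val) /= /val_inj. Qed.

Lemma big_chart_index (V : nmodType) (F : 'I_d.+1 -> V) (j : 'I_d.+1) :
  (j <= k)%N -> (forall i : 'I_d.+1, (k < i)%N -> F i = 0) ->
  \sum_i F i = F j + \sum_(i < k) F (chart_index j i).
Proof.
move=> jk F0; rewrite (bigD1_ord j)//=; congr (_ + _).
rewrite /chart_index -(big_ord_narrow (F := fun i => F (lift j i)) kd).
rewrite [RHS]big_mkcond; apply: eq_bigr => i _.
(* Here [j <= k <= i], so [lift j] sends [i] to [i + 1 > k], where [F] vanishes. *)
case: ltnP => // ki; apply: F0.
by rewrite /= /bump (leq_trans jk ki) add1n ltnS.
Qed.

Lemma sum_delta_coord m n (f : 'I_m -> 'I_n) (a : 'I_m -> R) i :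
  injective f -> (\sum_l a l *: 'e_(f l) : 'rV[R]_n) 0 (f i) = a i.
Proof.
move=> f_inj; rewrite summxE (bigD1 i)//= big1 => [|l li].
  by rewrite !mxE !eqxx mulr1 addr0.
by rewrite !mxE eqxx /= (inj_eq f_inj) eq_sym (negbTE li) mulr0.
Qed.

Lemma sum_delta_coord0 m n (f : 'I_m -> 'I_n) (a : 'I_m -> R) j :
  (forall i, f i != j) -> (\sum_l a l *: 'e_(f l) : 'rV[R]_n) 0 j = 0.
Proof.
move=> fj; rewrite summxE big1 // => l _.
by rewrite !mxE eqxx /= eq_sym (negbTE (fj l)) mulr0.
Qed.

Section Chart.
Variables (j : 'I_d.+1) (sg : R).
Hypotheses (jk : (j <= k)%N) (sg2 : sg * sg = 1).

Let U : set 'rV[R]_k := (fun u => dot u u) @^-1` [set b | b < 1].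
Let W : set 'rV[R]_d.+1 := 
  (fun x : 'rV[R]_d.+1 => sg * x 0 j) @^-1` [set b | 0 < b].
Let h (u : 'rV[R]_k) : R := 1 - dot u u.
(* h / sqrt h rather than sqrt h: only 1 / sqrt has its smoothness proved by a
   closed induction, its derivative being a polynomial in itself and h'. *)
Let s (u : 'rV[R]_k) : R := h u * (Num.sqrt (h u))^-1.
(** The open hemisphere on which coordinate [j] has the sign [sg], written as a graph over the unit
    ball of the other free coordinates. *)
Let phi (u : 'rV[R]_k) : 'rV[R]_d.+1 :=
  \sum_i u 0 i *: 'e_(chart_index j i) + (sg * s u) *: 'e_j.
Let psi (x : 'rV[R]_d.+1) : 'rV[R]_k := \sum_i x 0 (chart_index j i) *: 'e_i.

Let oU : open U.
Proof.
apply: open_comp (@open_lt R 1) => u _.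
exact: continuous_sqnorm.
Qed.

Let oW : open W.
Proof.
apply: open_comp (@open_gt R 0) => x _.
have FF := nbhs_filter (x : 'rV[R]_d.+1).
exact: (cvgM (cvg_cst sg) (@coord_continuous _ _ _ _ _ _)).
Qed.

Let sE u : U u -> s u = Num.sqrt (h u).
Proof.
move=> Uu; have h0 : 0 < h u by rewrite subr_gt0.
by rewrite /s -{1}(sqr_sqrtr (ltW h0)) expr2 mulfK// sqrtr_eq0 -ltNge.
Qed.

Let phi_j u : phi u 0 j = sg * s u.
Proof.
rewrite /phi mxE sum_delta_coord0 => [|i]; last by rewrite eq_sym neq_lift.
by rewrite !mxE !eqxx mulr1 add0r.
Qed.

Let phi_chart u i : phi u 0 (chart_index j i) = u 0 i.
Proof.
rewrite /phi mxE sum_delta_coord; last exact: chart_index_inj.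
by rewrite !mxE eqxx /= eq_sym (negbTE (neq_lift _ _)) mulr0 addr0.
Qed.

Let phi_out u (i : 'I_d.+1) : (k < i)%N -> phi u 0 i = 0.
Proof.
move=> ki; rewrite /phi mxE sum_delta_coord0 => [|l].
  rewrite !mxE eqxx /=; case: eqP => [ij|]; last by rewrite mulr0 addr0.
  by rewrite ij ltnNge jk in ki.
apply/eqP => /(congr1 val) /= li; rewrite -li /= in ki.
move: ki; rewrite ltnNge /bump => /negP; apply.
by case: (j <= l)%N; rewrite ?add1n ?add0n ?(ltn_ord l) ?(ltnW (ltn_ord l)).
Qed.

Let psiE x i : psi x 0 i = x 0 (chart_index j i).
Proof. exact: (sum_delta_coord _ _ id (fun l => x 0 (chart_index j l)) i). Qed.

Let sphere_split x : S x -> x 0 j ^+ 2 + dot (psi x) (psi x) = 1.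
Proof.
move=> [x1 xk]; rewrite -x1 [RHS](big_chart_index _ _ _ jk) => [|i ki].
  by rewrite expr2; congr (_ + _); apply: eq_bigr => i _; rewrite psiE.
by rewrite xk ?mul0r.
Qed.

Lemma sphere_chart : [/\ open U, open W &
  [/\ smooth_on U phi, smooth_on W psi, phi @` U = S `&` W &
      forall u, U u -> psi (phi u) = u]].
Proof.
split=> //; split.
- move=> n.
  have h_smooth m : Cn_on m U h.
    apply: (Cn_on_eq _ _ _ _
      (fun u : 'rV[R]_k => 1 + -1 * \sum_i u 0 i * u 0 i)) => //.
      by move=> u _; rewrite mulN1r.
    apply: Cn_onD => //; first exact: Cn_on_cst.
    apply: Cn_onM => //; first exact: Cn_on_cst.
    apply: Cn_on_sum => // i.
    by apply: Cn_onM => //; exact: Cn_on_coord.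
  apply: Cn_onD => //.
    by apply: Cn_on_sum => // i; apply: Cn_onZl => //; exact: Cn_on_coord.
  apply: Cn_onZl => //; apply: Cn_onM => //; first exact: Cn_on_cst.
  apply: Cn_onM => //; apply: Cn_on_inv_sqrt => // u Uu.
  by rewrite subr_gt0.
- move=> n; apply: Cn_on_sum => // i.
  by apply: Cn_onZl => //; exact: Cn_on_coord.
- apply/seteqP; split=> [_ [u Uu <-]|x [Sx Wx]].
    have h0 : 0 < h u by rewrite subr_gt0.
    split; last first.
      by rewrite /W /= phi_j mulrA sg2 mul1r sE// sqrtr_gt0.
    split; last exact: phi_out.
    rewrite /dot (big_chart_index _ _ j jk) => [|i ki]; last first.
      by rewrite phi_out ?mul0r.
    rewrite phi_j mulrACA sg2 mul1r sE// -expr2 sqr_sqrtr ?ltW//.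
    under eq_bigr do rewrite phi_chart.
    by rewrite subrK.
  have xj := sphere_split _ Sx; have [x1 xk] := Sx.
  have xj2 : 0 < x 0 j ^+ 2.
    rewrite lt_def sqr_ge0 sqrf_eq0 andbT; apply/eqP => xj0.
    by move: Wx; rewrite /W /= xj0 mulr0 ltxx.
  have Upsi : U (psi x) by rewrite /U /=; lra.
  exists (psi x) => //; rewrite /phi sE//.
  have -> : h (psi x) = (sg * x 0 j) ^+ 2.
    by rewrite exprMn expr2 sg2 mul1r /h -xj addrK.
  rewrite sqrtr_sqr gtr0_norm// mulrA sg2 mul1r addrC.
  rewrite [RHS]row_sum_delta (big_chart_index _ _ j jk) => [|i ki]; last first.
    by rewrite xk ?scale0r.
  by congr (_ + _); apply: eq_bigr => i _; rewrite psiE.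
- by move=> u Uu; apply/rowP => i; rewrite psiE phi_chart.
Qed.

End Chart.

Lemma sphere_manifold : bounded_smooth_manifold k S.
Proof.
split; [|exact: closed_sphere|exact: bounded_sphere].
move=> p [p1 pk].
have [j pj] : exists j, p 0 j != 0.
  apply/existsP; rewrite -negb_forall; apply/negP => /forallP p0.
  have : dot p p = 0 by apply: big1 => i _; rewrite (eqP (p0 i)) mul0r.
  by rewrite p1 => /eqP; rewrite oner_eq0.
have jk : (j <= k)%N by rewrite leqNgt; apply: contra pj => /pk ->.
have sg2 : Num.sg (p 0 j) * Num.sg (p 0 j) = 1.
  by rewrite -expr2 sqr_sg pj.
have [oU oW [sphi spsi phiU phiK]] := sphere_chart _ _ jk sg2.
do 4 eexists; split; last first.
  by split; [exact: sphi|exact: spsi|exact: phiU|exact: phiK].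
by split=> //=; rewrite -normrEsg normr_gt0.
Qed.

End SphereManifold.

(** * The medial axis of the k-sphere *)

Section SphereMedial.
Context {R : realType} {d k : nat}.
Local Notation S := (sphere R d.+1 k).
Implicit Types (p q x y z : 'rV[R]_d.+1).

Lemma sphereN z : S z -> S (- z).
Proof.
move=> [z1 zk]; split=> [|i ki]; first by rewrite dotNl dotNr opprK.
by rewrite mxE zk ?oppr0.
Qed.

Lemma sphere_normalize z : z != 0 ->
  (forall i : 'I_d.+1, (k < i)%N -> z 0 i = 0) ->
  S ((Num.sqrt (dot z z))^-1 *: z).
Proof.
move=> z0 zk; split=> [|i ki]; last by rewrite mxE zk ?mulr0.
rewrite dotZl dotZr mulrA -expr2 exprVn sqr_sqrtr ?dot_ge0//.
by rewrite mulVf// dot_eq0.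
Qed.

Lemma sqr_dist_sphere y z : S z ->
  eucl_dist y z ^+ 2 = dot y y + 1 - 2 * dot y z.
Proof. by move=> [z1 _]; rewrite sqr_dist !dotE z1 (dotC z y); lra. Qed.

(** All points of [S] have norm 1, so [|yz|^2] depends on [z] only through [-2 * dot y z]. *)
Lemma nearest_sphereP y p : nearest_point S y p <->
  S p /\ forall z, S z -> dot y z <= dot y p.
Proof.
have h z : S p -> S z -> (eucl_dist y p <= eucl_dist y z) =
    (dot y z <= dot y p).
  move=> Sp Sz; rewrite -ler_sqr ?nnegrE ?dist_ge0// !sqr_dist_sphere//.
  by apply/idP/idP; lra.
by split=> -[Sp pP]; split=> // z Sz; [rewrite -h|rewrite h] => //; exact: pP.
Qed.

(* The normalised midpoint of two distinct nearest points would be nearer,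
   unless [y] is orthogonal to the whole sphere. *)
Lemma nearest_sphere_not_unique y p q z : p != q ->
  nearest_point S y p -> nearest_point S y q -> S z -> dot y z = 0.
Proof.
move=> pq /nearest_sphereP[Sp pP] /nearest_sphereP[Sq qP] Sz.
have ypq : dot y p = dot y q by apply/le_anti; rewrite pP ?qP.
(* [dot y p] is the maximum of [dot y] over [S]; once it is nonpositive, comparing with [z] and
   [- z] leaves only 0. *)
suff yp0 : dot y p <= 0.
  have := pP _ Sz; have := pP _ (sphereN _ Sz); rewrite dotNr; lra.
have [pq0|pq0] := eqVneq (p + q) 0.
  have : dot y (p + q) = 0 by rewrite pq0 dot0r.
  by rewrite dotDr; lra.
have mk (i : 'I_d.+1) : (k < i)%N -> (p + q) 0 i = 0.
  by move=> ki; rewrite mxE (Sp.2 _ ki) (Sq.2 _ ki) addr0.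
have := pP _ (sphere_normalize _ pq0 mk).
set n := Num.sqrt _; rewrite dotZr dotDr -ypq.
have n0 : 0 < n by rewrite sqrtr_gt0 dot_gt0.
(* Parallelogram law: [|p + q|^2 = 4 - |p - q|^2]. *)
have n2 : n < 2.
  rewrite -ltr_sqr ?nnegrE ?ltW// sqr_sqrtr ?dot_ge0//.
  have : 0 < dot (p - q) (p - q) by rewrite dot_gt0 subr_eq0.
  by rewrite !dotE Sp.1 Sq.1 (dotC q p); lra.
rewrite mulrC ler_pdivrMr// => h; have : 0 <= (n - 2) * dot y p by lra.
by rewrite nmulr_rge0 ?subr_lt0.
Qed.

(** A point [y] with two nearest points is orthogonal to [p], so [|py|^2 = |y|^2 + 1]; the resulting
    inequality is closed and passes to the closure. *)
Lemma medial_sphere_dist m p : medial_axis S m -> S p -> 1 <= eucl_dist p m.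
Proof.
move=> Mm Sp.
suff : medial_axis S `<=` eucl_dist p @^-1` [set b | 1 <= b] by apply.
have cl : closed (eucl_dist p @^-1` [set b | 1 <= b]).
  by apply: preimage_closed (@closed_ge R 1) => y _; exact: continuous_dist.
rewrite [X in _ `<=` X](closure_id _).1//; apply: closure_subset.
move=> y [a [b [ab ya yb]]] /=.
rewrite -ler_sqr ?nnegrE ?dist_ge0// expr1n distC sqr_dist_sphere//.
rewrite (nearest_sphere_not_unique _ _ _ _ ab ya yb Sp).
have := dot_ge0 y; lra.
Qed.

Lemma nearest_sphere0 p : S p -> nearest_point S 0 p.
Proof. by move=> Sp; apply/nearest_sphereP; split=> // z _; rewrite !dot0l. Qed.

Lemma medial_sphere0 p : S p -> medial_axis S 0.
Proof.
move=> Sp; apply: subset_closure; exists p, (- p); split.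
- apply/eqP => /(congr1 (dot p)); rewrite dotNr Sp.1; lra.
- exact: nearest_sphere0.
- exact/nearest_sphere0/sphereN.
Qed.

Lemma dist_sphere0 p : S p -> eucl_dist p 0 = 1.
Proof. by move=> [p1 _]; rewrite dist0 p1 sqrtr1. Qed.

Lemma lfs_sphere p : S p -> lfs S p = 1.
Proof.
move=> Sp; have M0 := medial_sphere0 _ Sp.
apply/le_anti/andP; split; first by rewrite -(dist_sphere0 _ Sp) lfs_le.
apply: lb_le_inf; first by exists (eucl_dist p 0), 0.
by move=> _ [m Mm <-]; exact: medial_sphere_dist.
Qed.

Lemma ebs_sphere p : S p -> ebs S p = 1.
Proof.
move=> Sp; have M0 := medial_sphere0 _ Sp; have p0 := nearest_sphere0 _ Sp.
apply/le_anti/andP; split; first by rewrite -(dist_sphere0 _ Sp) ebs_le.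
apply: lb_le_inf.
  by exists (eucl_dist p 0), 0 => //; split=> //; exact: nearest_point_normal.
by move=> _ [m [Mm _] <-]; exact: medial_sphere_dist.
Qed.

(** Equality of the two power functions at [x] reads [1 - r^2 + |xc|^2 = |x|^2], so the claim
    becomes [|x xt| = 1 - |x|]. *)
Lemma sphere_sharp n (v : 'I_n.+1 -> 'rV[R]_d.+1) x xt c (r : R) :
  (forall i, S (v i)) -> simplex v x -> ~ medial_axis S x ->
  nearest_point S x xt -> circumscribes c r v ->
  eucl_dist x xt = 1 - Num.sqrt (1 - r ^+ 2 + eucl_dist x c ^+ 2).
Proof.
move=> vS [a [a_ge0 a1 xE]] xM /nearest_sphereP[Sxt xtP] vcr.
have x0 : x != 0.
  by apply/eqP => x0; apply: xM; rewrite x0; exact: medial_sphere0 (vS ord0).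
have xk (i : 'I_d.+1) : (k < i)%N -> x 0 i = 0.
  move=> ki; rewrite xE summxE big1// => l _.
  by rewrite mxE (vS l).2 ?mulr0.
set rho := eucl_dist x 0.
have rho0 : 0 < rho by rewrite /rho dist0 sqrtr_gt0 dot_gt0.
have rhoE : dot x x = rho ^+ 2 by rewrite /rho sqr_dist subr0.
have sum0 := sum_sqr_dist_simplex _ _ _ 0 a1 xE.
have sumc := sum_sqr_dist_simplex _ _ _ c a1 xE.
have {}sum0 : 1 = rho ^+ 2 + \sum_i a i * eucl_dist (v i) x ^+ 2.
  rewrite -sum0 -[LHS]a1; apply: eq_bigr => i _.
  by rewrite dist_sphere0// expr1n mulr1.
have {}sumc : r ^+ 2 = eucl_dist x c ^+ 2 + \sum_i a i * eucl_dist (v i) x ^+ 2.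
  rewrite -sumc -[LHS]mul1r -a1 mulr_suml; apply: eq_bigr => i _.
  by rewrite distC vcr.
have -> : 1 - r ^+ 2 + eucl_dist x c ^+ 2 = rho ^+ 2 by lra.
rewrite sqrtr_sqr gtr0_norm//.
have rho1 : rho <= 1.
  rewrite -ler_sqr ?nnegrE ?(ltW rho0)// expr1n.
  have : 0 <= \sum_i a i * eucl_dist (v i) x ^+ 2.
    by apply: sumr_ge0 => i _; rewrite mulr_ge0// sqr_ge0.
  lra.
(* [xt] is the radial projection of [x]: Cauchy-Schwarz bounds the inner product above, and the
   competitor [x / |x|] in [S] bounds it below. *)
have x_xt : dot x xt = rho.
  apply/le_anti/andP; split.
    rewrite (le_trans (ler_norm _))// -ler_sqr ?nnegrE ?(ltW rho0)//.
    rewrite real_normK ?num_real// -rhoE -[leRHS]mulr1 -Sxt.1.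
    exact: cauchy_schwarz.
  have := xtP _ (sphere_normalize _ x0 xk).
  by rewrite dotZr -dist0 -/rho rhoE expr2 mulKf// gt_eqF.
apply/eqP; rewrite -(eqrXn2 (n := 2)) ?dist_ge0 ?subr_ge0//.
by rewrite sqr_dist_sphere// x_xt rhoE; apply/eqP; ring.
Qed.

End SphereMedial.

Theorem lemma1 (R : realType) :
  (* the two chains of inequalities, with one absolute constant K for the
     big-O terms; the last clause of each chain is the sharpness of its second
     inequality *)
  (exists K : R, forall (d k : nat) (Sigma : set 'rV[R]_d),
    bounded_smooth_manifold k Sigma ->
    forall (n : nat) (v : 'I_n.+1 -> 'rV[R]_d),
    affinely_independent v -> (forall i, Sigma (v i)) ->
    forall (c : 'rV[R]_d) (r : R), simplex v `<=` cball c r ->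
    forall x xt : 'rV[R]_d,
    simplex v x -> ~ medial_axis Sigma x -> nearest_point Sigma x xt ->
    (r < ebs Sigma xt ->
      [/\ eucl_dist x xt <=
            ebs Sigma xt -
              Num.sqrt (ebs Sigma xt ^+ 2 - r ^+ 2 + eucl_dist x c ^+ 2),
          ebs Sigma xt -
            Num.sqrt (ebs Sigma xt ^+ 2 - r ^+ 2 + eucl_dist x c ^+ 2) <=
            ebs Sigma xt - Num.sqrt (ebs Sigma xt ^+ 2 - r ^+ 2),
          `|ebs Sigma xt - Num.sqrt (ebs Sigma xt ^+ 2 - r ^+ 2)
            - r ^+ 2 / (2 * ebs Sigma xt)| <= K * (r ^+ 4 / ebs Sigma xt ^+ 3) &
          x = c ->
          ebs Sigma xt -
            Num.sqrt (ebs Sigma xt ^+ 2 - r ^+ 2 + eucl_dist x c ^+ 2) =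
            ebs Sigma xt - Num.sqrt (ebs Sigma xt ^+ 2 - r ^+ 2)]) /\
    (r < lfs Sigma xt ->
      [/\ eucl_dist x xt <=
            lfs Sigma xt -
              Num.sqrt (lfs Sigma xt ^+ 2 - r ^+ 2 + eucl_dist x c ^+ 2),
          lfs Sigma xt -
            Num.sqrt (lfs Sigma xt ^+ 2 - r ^+ 2 + eucl_dist x c ^+ 2) <=
            lfs Sigma xt - Num.sqrt (lfs Sigma xt ^+ 2 - r ^+ 2),
          `|lfs Sigma xt - Num.sqrt (lfs Sigma xt ^+ 2 - r ^+ 2)
            - r ^+ 2 / (2 * lfs Sigma xt)| <= K * (r ^+ 4 / lfs Sigma xt ^+ 3) &
          x = c ->
          lfs Sigma xt -
            Num.sqrt (lfs Sigma xt ^+ 2 - r ^+ 2 + eucl_dist x c ^+ 2) =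
            lfs Sigma xt - Num.sqrt (lfs Sigma xt ^+ 2 - r ^+ 2)]))
  /\
  (* sharpness of the first inequality of each chain; Sigma is nonempty and its
     ebs and lfs are genuine minima, so the claim is not vacuous *)
  (forall d k : nat, (k < d)%N ->
    exists Sigma : set 'rV[R]_d,
    [/\ bounded_smooth_manifold k Sigma, Sigma !=set0,
        (forall p, Sigma p ->
           (medial_axis Sigma `&` normal_flat Sigma p) !=set0) &
        forall (n : nat) (v : 'I_n.+1 -> 'rV[R]_d),
        affinely_independent v -> (forall i, Sigma (v i)) ->
        forall x xt : 'rV[R]_d,
        simplex v x -> ~ medial_axis Sigma x -> nearest_point Sigma x xt ->
        forall (c : 'rV[R]_d) (r : R),
        circumscribes c r v -> r < ebs Sigma xt ->
        eucl_dist x xt =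
          ebs Sigma xt -
            Num.sqrt (ebs Sigma xt ^+ 2 - r ^+ 2 + eucl_dist x c ^+ 2) /\
        eucl_dist x xt =
          lfs Sigma xt -
            Num.sqrt (lfs Sigma xt ^+ 2 - r ^+ 2 + eucl_dist x c ^+ 2)]).
Proof.
split.
  exists 2^-1 => d k S [_ clS bS] n v _ vS c r vcr x xt vx _ near_xt.
  have cS := bounded_closed_compact bS clS.
  have r0 : 0 <= r := le_trans (dist_ge0 c x) (vcr _ vx).
  split=> re; split.
  - apply: (dist_nearest_le_ball _ _ _ _ _ _ _ cS vS vcr vx near_xt re) => m.
    exact: ebs_le.
  - exact: sub_sqrt_le.
  - exact: sub_sqrt_expansion.
  - by move=> ->; rewrite distxx expr0n addr0.
  - apply: (dist_nearest_le_ball _ _ _ _ _ _ _ cS vS vcr vx near_xt re) => m Mm _.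
    exact: lfs_le.
  - exact: sub_sqrt_le.
  - exact: sub_sqrt_expansion.
  - by move=> ->; rewrite distxx expr0n addr0.
(* In dimension [d.+1] the hypothesis is [k <= d], which leaves room for the [k + 1] free
   coordinates; in dimension 0 no [k] qualifies. *)
case=> [|d] k // kd; exists (sphere R d.+1 k); split.
- exact: sphere_manifold.
- exists 'e_ord0; split=> [|i ki]; last first.
    by rewrite mxE eqxx /=; case: eqP ki => // ->.
  rewrite /dot (bigD1 ord0)//= big1 => [|i i0]; rewrite !mxE.
    by rewrite !eqxx mulr1 addr0.
  by rewrite (negbTE i0) andbF mulr0.
- move=> p Sp; exists 0; split; first exact: medial_sphere0 Sp.
  exact/nearest_point_normal/nearest_sphere0.
- move=> n v _ vS x xt vx xM near_xt c r vcr _.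
  rewrite ebs_sphere ?lfs_sphere ?expr1n; try by case: near_xt.
  by split; exact: (sphere_sharp _ _ _ _ _ _ vS vx xM near_xt vcr).
Qed.
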